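(* With probability one there exists $n_0$ such that for every $n\ge n_0$ the function $\mathbb R^3\ni(\alpha',\theta_1',\theta_2')\mapsto Q_n(\mathbf Y_n;\alpha',\theta_1',\theta_2')$ has a unique global minimizer, denoted $(\tilde\alpha_n,\tilde\theta_{1,n},\tilde\theta_{2,n})$. Moreover, for every $(\alpha,\theta_1,\theta_2)\in(0,1)\times\mathbb N^2$, almost surely $\tilde\alpha_n\to\alpha$ and $$\begin{bmatrix}\tilde\theta_{1,n}\\ \tilde\theta_{2,n}\end{bmatrix}\to\begin{bmatrix}Y_s\\ Y_{s+1}\end{bmatrix}+\frac{1}{1+\alpha^2+\alpha^4}\begin{bmatrix}-\alpha(1+\alpha^2)Y_{s-1}-\alpha^2Y_{s+2}-(1-\alpha^3)\mu_\varepsilon\\ -\alpha^2Y_{s-1}-\alpha(1+\alpha^2)Y_{s+2}-(1-\alpha^3)\mu_\varepsilon\end{bmatrix}.$$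
   Context: INAR(1) process: Let $\alpha\in(0,1)$. Let $(\varepsilon_k)_{k\in\mathbb N}$ be i.i.d. non-negative integer-valued random variables with $\mathbb E\varepsilon_1^2<\infty$ and $\mathbb P(\varepsilon_1\ne 0)>0$; write $\mu_\varepsilon=\mathbb E\varepsilon_1$ (assumed known). For each $k\in\mathbb N$ let $(\xi_{k,j})_{j\in\mathbb N}$ be i.i.d. Bernoulli random variables with mean $\alpha$, these sequences being mutually independent and independent of $(\varepsilon_k)$. Let $X_0$ be a non-negative integer-valued random variable with $\mathbb E X_0^2<\infty$, independent of all $\xi_{k,j}$ and $\varepsilon_k$, and set $X_k=\sum_{j=1}^{X_{k-1}}\xi_{k,j}+\varepsilon_k$ for $k\in\mathbb N$. Two neighbouring additive outliers: fix a known $s\in\mathbb N$ and sizes $\theta_1,\theta_2\in\mathbb N$; $Y_k=X_k+\delta_{k,s}\theta_1+\delta_{k,s+1}\theta_2$, $k\in\mathbb Z_+$; $\mathbf Y_n=(Y_0,\dots,Y_n)$. For $n\ge s+2$, $$Q_n(\mathbf y_n;\alpha',\theta_1',\theta_2')=\sum_{\substack{k=1\\k\notin\{s,s+1,s+2\}}}^n(y_k-\alpha'y_{k-1}-\mu_\varepsilon)^2+(y_s-\alpha'y_{s-1}-\mu_\varepsilon-\theta_1')^2+(y_{s+1}-\alpha'y_s-\mu_\varepsilon+\alpha'\theta_1'-\theta_2')^2+(y_{s+2}-\alpha'y_{s+1}-\mu_\varepsilon+\alpha'\theta_2')^2 .$$ *)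

(* Defs.v *)
From HB Require Import structures.
From mathcomp Require Import all_boot all_order all_algebra.
From mathcomp Require Import all_classical all_reals all_analysis.
Set Implicit Arguments. Unset Strict Implicit. Unset Printing Implicit Defensive.
Import Order.TTheory GRing.Theory Num.Theory.
Import numFieldNormedType.Exports.
Local Open Scope classical_set_scope.
Local Open Scope ring_scope.

Definition mutually_independent d (T : measurableType d) (R : realType)
  (P : probability T R) (I : eqType) (Z : I -> T -> nat) : Prop :=
  forall (J : seq I) (v : I -> nat), uniq J ->
    P (\bigcap_(i in [set` J]) (Z i @^-1` [set v i])) =
    (\prod_(i <- J) P (Z i @^-1` [set v i]))%E.

(* Index of the driving variables:
   None            <-> X_0
   Some (inl k)    <-> eps_{k+1}
   Some (inr (k,j))<-> xi_{k+1,j+1}  *)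
Definition inar_index := option (nat + (nat * nat))%type.

Definition inar_family (T : Type) (X0 : T -> nat) (eps : nat -> T -> nat)
  (xi : nat -> nat -> T -> nat) (i : inar_index) : T -> nat :=
  match i with
  | None => X0
  | Some (inl k) => eps k.+1
  | Some (inr (k, j)) => xi k.+1 j.+1
  end.

Fixpoint inar (T : Type) (X0 : T -> nat) (eps : nat -> T -> nat)
  (xi : nat -> nat -> T -> nat) (k : nat) (w : T) : nat :=
  match k with
  | 0 => X0 w
  | k'.+1 => (\sum_(j < inar X0 eps xi k' w) xi k'.+1 j.+1 w + eps k'.+1 w)%N
  end.

Definition inar_ao (T : Type) (X0 : T -> nat) (eps : nat -> T -> nat)
  (xi : nat -> nat -> T -> nat) (s th1 th2 : nat) (k : nat) (w : T) : nat :=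
  (inar X0 eps xi k w + (k == s) * th1 + (k == s.+1) * th2)%N.

Definition Qn (R : realType) (mu : R) (s n : nat) (y : nat -> R) (a t1 t2 : R) : R :=
  \sum_(1 <= k < n.+1 | (k != s) && (k != s.+1) && (k != s.+2))
     (y k - a * y k.-1 - mu) ^+ 2
  + (y s - a * y s.-1 - mu - t1) ^+ 2
  + (y s.+1 - a * y s - mu + a * t1 - t2) ^+ 2
  + (y s.+2 - a * y s.+1 - mu + a * t2) ^+ 2.

(* Main.v *)
(* Write [M_k = X_k - alpha X_{k-1} - mu], [A_n = 1 + sum_{k <= n} X_{k-1}^2] and
   [N_n = sum_{k <= n} X_{k-1} M_k].

   Only second moments are available, so [N_n] need not be square integrable; but
   [X_{k-1} <= sqrt A_k] makes [N_n^2 / A_n^(7/4) + kappa / A_n^(1/4)] a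
   nonnegative supermartingale for a suitable constant [kappa].  By Doob's maximal
   inequality it is almost surely bounded in [n].  Since [A_n] tends to infinity
   (infinitely many innovations are nonzero), [N_n / A_n] tends to [0].  The maximal
   inequality is proved without conditional expectations, by revealing the driving
   variables one at a time on events that are independent of the variables not yet
   revealed.

   In terms of [tau_1 = y_s - theta_1] and [tau_2 = y_{s+1} - theta_2], the objective
   is [(a - alpha)^2 A - 2 (a - alpha) N + D] plus three squared residuals that do not
   depend on [n].  Minimising over [tau_1, tau_2] for fixed [a] is explicit, and the
   intermediate value theorem gives a critical point with [a] close to [alpha] as soon
   as [A] is large and [N / A] small.  An exact Taylor expansion shows that such a
   critical point is the strict global minimum once [A] exceeds a fixed bound. *)
Require Import Defs.
From HB Require Import structures.
From mathcomp Require Import all_boot all_order all_algebra.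
From mathcomp Require Import all_classical all_reals all_analysis.
From mathcomp Require Import measurable_realfun.
From mathcomp Require Import ring lra.
Set Implicit Arguments.
Unset Strict Implicit.
Unset Printing Implicit Defensive.
Import Order.TTheory GRing.Theory Num.Theory.
Import numFieldNormedType.Exports.
Local Open Scope classical_set_scope.
Local Open Scope ring_scope.

(** * Countably valued maps *)

Section DiscreteMaps.
Context (d : measure_display) (T : measurableType d).

(* Coding through [nat] gives closure under pairing without asking for any
   measurable structure on the codomain. *)
Definition discrete_map (U : Type) (f : T -> U) : Prop :=
  exists (c : T -> nat) (h : nat -> U),
    (forall n, measurable (c @^-1` [set n])) /\ f = h \o c.

Lemma discrete_map_nat (f : T -> nat) :
  (forall n, measurable (f @^-1` [set n])) -> discrete_map f.
Proof. by move=> mf; exists f, id. Qed.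

Lemma discrete_map_measurable (U : Type) (f : T -> U) (A : set U) :
  discrete_map f -> measurable (f @^-1` A).
Proof.
move=> [c [h [mc ->]]].
have -> : (h \o c) @^-1` A = \bigcup_(n in h @^-1` A) c @^-1` [set n].
  by apply/seteqP; split=> [w Aw|w [n /= An /= ->]] //; exists (c w).
exact: bigcup_measurable.
Qed.

Lemma discrete_map_comp (U V : Type) (g : U -> V) (f : T -> U) :
  discrete_map f -> discrete_map (g \o f).
Proof. by move=> [c [h [mc ->]]]; exists c, (g \o h). Qed.

Lemma discrete_map_cst (U : Type) (u : U) : discrete_map (fun=> u : U).
Proof.
exists (fun=> 0%N), (fun=> u); split=> // n.
by rewrite preimage_cst; case: ifP.
Qed.

Lemma discrete_map_pair (U V : Type) (f : T -> U) (g : T -> V) :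
  discrete_map f -> discrete_map g -> discrete_map (fun w => (f w, g w)).
Proof.
move=> [c [h [mc ->]]] [c' [h' [mc' ->]]].
(* The [else] branch is a default never reached from [T], where [unpickle] inverts [pickle]. *)
exists (fun w => pickle (c w, c' w)),
  (fun n => if unpickle n is Some (a, b) then (h a, h' b) else (h 0%N, h' 0%N)).
split=> [n|]; last by apply/funext => w /=; rewrite pickleK.
have -> : (fun w => pickle (c w, c' w)) @^-1` [set n] =
  \bigcup_a \bigcup_(b in [set b | pickle (a, b) = n])
    (c @^-1` [set a] `&` c' @^-1` [set b]).
  apply/seteqP; split=> [w /= wn|w [a _ [b /= abn [/= -> ->]]]] //.
  by exists (c w) => //; exists (c' w).
apply: bigcupT_measurable => a; apply: bigcup_measurable => b _.
exact: measurableI.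
Qed.

Lemma discrete_map2 (U V W : Type) (op : U -> V -> W) (f : T -> U) (g : T -> V) :
  discrete_map f -> discrete_map g -> discrete_map (fun w => op (f w) (g w)).
Proof.
by move=> df dg; apply: (discrete_map_comp (fun p => op p.1 p.2) (discrete_map_pair df dg)).
Qed.

(** On each level set of [f] the index is constant. This makes sums with a random number of terms
    measurable. *)
Lemma discrete_map_diag (f : T -> nat) (g : nat -> T -> nat) :
  discrete_map f -> (forall n, discrete_map (g n)) ->
  discrete_map (fun w => g (f w) w).
Proof.
move=> df dg; apply: discrete_map_nat => n.
have -> : (fun w => g (f w) w) @^-1` [set n] =
  \bigcup_y (f @^-1` [set y] `&` g y @^-1` [set n]).
  apply/seteqP; split=> [w wn|w [y _ [/= -> //]]].
  by exists (f w).
by apply: bigcupT_measurable => y; apply: measurableI;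
  apply: discrete_map_measurable.
Qed.

Lemma discrete_map_sum (V : nmodType) n (g : nat -> T -> V) :
  (forall j, discrete_map (g j)) ->
  discrete_map (fun w => \sum_(j < n) g j w).
Proof.
move=> dg; elim: n => [|n IHn].
  have -> : (fun w => \sum_(j < 0) g j w) = fun=> 0.
    by apply/funext => w; rewrite big_ord0.
  exact: discrete_map_cst.
have -> : (fun w => \sum_(j < n.+1) g j w) =
          fun w => \sum_(j < n) g j w + g n w.
  by apply/funext => w; rewrite big_ord_recr.
exact: discrete_map2.
Qed.

Lemma discrete_map_measurable_fun (d' : measure_display) (U : measurableType d')
    (f : T -> U) :
  discrete_map f -> measurable_fun setT f.
Proof. by move=> df _ Y _; rewrite setTI; apply: discrete_map_measurable. Qed.

End DiscreteMaps.

(** * Splitting measures and integrals along an integer-valued variable *)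

Section NatSplitting.
Context (d : measure_display) (T : measurableType d) (R : realType).
Context (P : probability T R).

Lemma bigcup_nat_preimage (f : T -> nat) : \bigcup_n f @^-1` [set n] = setT.
Proof. by apply/seteqP; split=> // w _; exists (f w). Qed.

Lemma measure_nat_split (f : T -> nat) (E : set T) :
  (forall n, measurable (f @^-1` [set n])) -> measurable E ->
  (P E = \sum_(0 <= n <oo) P (f @^-1` [set n] `&` E))%E.
Proof.
move=> mf mE; rewrite -{1}(setTI E) -(bigcup_nat_preimage f) setI_bigcupl.
rewrite measure_semi_bigcup //.
- by move=> n; apply: measurableI.
- apply: trivIset_setIr; exact: trivIset_preimage1.
- by apply: bigcupT_measurable => n; apply: measurableI.
Qed.

Lemma integral_nat_split (f : T -> nat) (g : nat -> R) :
  (forall n, measurable (f @^-1` [set n])) -> (forall n, 0 <= g n) ->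
  (\int[P]_w (g (f w))%:E =
   \sum_(0 <= n <oo) (g n)%:E * P (f @^-1` [set n]))%E.
Proof.
move=> mf g0.
have mgf : measurable_fun setT ((fun w => (g (f w))%:E) : T -> \bar R).
  apply: discrete_map_measurable_fun.
  exact: (discrete_map_comp (fun n => (g n)%:E) (discrete_map_nat mf)).
rewrite -(bigcup_nat_preimage f) ge0_integral_bigcup //.
- apply: eq_eseriesr => n _; rewrite -integral_cst //.
  by apply: eq_integral => w; rewrite inE /= => ->.
- by rewrite bigcup_nat_preimage.
- by move=> w _; rewrite lee_fin.
- exact: trivIset_preimage1.
Qed.

End NatSplitting.

(** * Events independent of part of a family *)

Section IndependentOfFamily.
Context (d : measure_display) (T : measurableType d) (R : realType).
Context (P : probability T R) (I : eqType) (Z : I -> T -> nat).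
Hypothesis mZ : forall i n, measurable (Z i @^-1` [set n]).

(** Stands in for conditioning on what is already revealed: given [E], the variables indexed by [S]
    keep their joint law. *)
Definition indep_event (E : set T) (S : set I) : Prop :=
  measurable E /\ forall (J : seq I) (v : I -> nat), uniq J -> [set` J] `<=` S ->
    P (E `&` \bigcap_(i in [set` J]) (Z i @^-1` [set v i])) =
    (P E * \prod_(i <- J) P (Z i @^-1` [set v i]))%E.

Lemma indep_eventT : mutually_independent P Z -> indep_event setT setT.
Proof.
by move=> indep; split=> // J v uJ _; rewrite setTI indep// probability_setT mul1e.
Qed.

Lemma indep_event_sub E S S' : S' `<=` S -> indep_event E S -> indep_event E S'.
Proof. by move=> sub [mE iE]; split=> // J v uJ /subset_trans-/(_ _ sub); apply: iE. Qed.

Lemma indep_event_preimage E S i n : indep_event E S -> S i ->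
  (P (E `&` Z i @^-1` [set n]) = P E * P (Z i @^-1` [set n]))%E.
Proof.
move=> [mE iE] Si; have /(_ isT) := iE [:: i] (fun=> n).
by rewrite big_seq1 set_cons1 bigcap_set1; apply=> j /= ->.
Qed.

(** Reveals one variable: fixing the value of [Z i] uses up the index [i]. The product formula is
    applied to [i :: J] and regrouped. *)
Lemma indep_eventI E S i n : indep_event E S -> S i ->
  indep_event (E `&` Z i @^-1` [set n]) (S `\ i).
Proof.
move=> iES Si; split; first by apply: measurableI => //; case: iES.
move=> J v uJ JS; rewrite (indep_event_preimage _ iES) //.
have iJ : i \notin J by apply/negP => /JS /= [_ /(_ erefl)].
have [mE iE] := iES.
have iJE : [set` i :: J] = i |` [set` J].
  apply/seteqP; split=> j /=; rewrite in_cons; first by case/predU1P; [left|right].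
  by case=> [->|->]; rewrite ?eqxx ?orbT.
have := iE (i :: J) (fun j => if j == i then n else v j) _ _.
rewrite big_cons eqxx iJE bigcap_setU1 eqxx.
rewrite (eq_big_seq (fun j => P (Z j @^-1` [set v j]))); last first.
  by move=> j jJ; case: eqVneq => // ji; rewrite -ji jJ in iJ.
rewrite muleA -setIA => <- /=.
- congr (P (_ `&` (_ `&` _))); apply: eq_bigcapr => j /= jJ.
  by case: eqVneq => // ji; rewrite -ji jJ in iJ.
- by rewrite iJ.
- by move=> j [/= ->|/JS []].
Qed.

(** Plays the role of the tower property: bounds [g n] given [Z i = n] average to the mean of
    [g (Z i)]. Null values of [Z i] contribute nothing, so no bound is asked there. *)
Lemma indep_event_split_le E S F i (g : nat -> R) :
  indep_event E S -> S i -> measurable F -> (forall n, 0 <= g n) ->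
  (forall n, (0 < P (Z i @^-1` [set n]))%E ->
    (P (E `&` Z i @^-1` [set n] `&` F) <= P (E `&` Z i @^-1` [set n]) * (g n)%:E)%E) ->
  (P (E `&` F) <= P E * \int[P]_w (g (Z i w))%:E)%E.
Proof.
move=> iES Si mF g0 H; have mE : measurable E by case: iES.
rewrite (@measure_nat_split _ _ _ P (Z i)) //; last exact: measurableI.
have PE : P E = (fine (P E))%:E by rewrite fineK // fin_num_measure.
rewrite integral_nat_split // PE -nneseriesZl -?PE; last first.
  by move=> n _; apply: mule_ge0 => //; rewrite lee_fin.
apply: lee_nneseries => // n _.
have [p0|] := ltP 0%E (P (Z i @^-1` [set n])).
  rewrite setICA setIA (le_trans (H n p0)) // (indep_event_preimage _ iES) //.
  by rewrite -muleA (muleC (P (Z _ @^-1` _))).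
move=> p0; have -> : P (Z i @^-1` [set n] `&` (E `&` F)) = 0%E.
  apply/eqP; rewrite eq_le measure_ge0 andbT; apply: le_trans p0.
  by apply: le_measure; rewrite ?inE; do ?[exact: measurableI | apply: measurableI].
by rewrite mule_ge0 // mule_ge0 // lee_fin.
Qed.

End IndependentOfFamily.

(** * Moments of integer-valued variables *)

Section Moments.
Context (d : measure_display) (T : measurableType d) (R : realType).
Context (P : probability T R).

Lemma integral_bernoulli (f : T -> nat) (p : R) (g : nat -> R) :
  (forall n, measurable (f @^-1` [set n])) -> (forall n, 0 <= g n) ->
  P (f @^-1` [set 1%N]) = p%:E -> P (f @^-1` [set 0%N]) = (1 - p)%:E ->
  (\int[P]_w (g (f w))%:E = ((1 - p) * g 0%N + p * g 1%N)%:E)%E.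
Proof.
move=> mf g0 f1 f0; rewrite integral_nat_split //.
(* The masses at [0] and [1] add up to [1], so every other value is null. *)
have tail n : (2 <= n)%N -> P (f @^-1` [set n]) = 0%E.
  move=> n2; set D := f @^-1` [set 0%N] `|` f @^-1` [set 1%N].
  have mD : measurable D by apply: measurableU.
  have PD : P D = 1%E.
    transitivity (P (f @^-1` [set 0%N]) + P (f @^-1` [set 1%N]))%E.
      by apply: measureU => //; apply/seteqP; split=> // w [/= ->].
    by rewrite f1 f0 -EFinD subrK.
  apply/eqP; rewrite eq_le measure_ge0 andbT.
  have -> : 0%E = P (~` D) :> \bar R by rewrite probability_setC // PD subee.
  apply: le_measure; rewrite ?inE //; first exact: measurableC.
  by move=> w /= fn [] /= fw; rewrite -fn fw in n2.
rewrite (@nneseries_split _ _ 0%N 2%N) //; last first.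
  by move=> n _; rewrite mule_ge0 // lee_fin.
rewrite add0n eseries0 => [|n n2 _]; last by rewrite tail // mule0.
rewrite adde0 big_nat_recr // big_nat1 /= f0 f1 -!EFinM -EFinD.
by congr (_%:E); ring.
Qed.

Lemma integrable_nat (f : T -> nat) :
  (forall n, measurable (f @^-1` [set n])) ->
  (\int[P]_w (((f w)%:R : R) ^+ 2)%:E < +oo)%E ->
  P.-integrable setT (fun w => (((f w)%:R : R) ^+ 2)%:E) /\
  P.-integrable setT (fun w => ((f w)%:R : R)%:E).
Proof.
move=> mf f2.
have mh (h : nat -> R) : measurable_fun setT (fun w => (h (f w))%:E).
  apply: discrete_map_measurable_fun.
  exact: (discrete_map_comp (fun n => (h n)%:E) (discrete_map_nat mf)).
have i2 : P.-integrable setT (fun w => (((f w)%:R : R) ^+ 2)%:E).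
  apply/integrableP; split; first exact: (mh (fun n => n%:R ^+ 2)).
  under eq_integral do rewrite gee0_abs ?lee_fin ?sqr_ge0 //.
  exact: f2.
split=> //; apply: le_integrable i2 => //.
move=> w _; rewrite !gee0_abs ?lee_fin ?sqr_ge0 //.
by rewrite -natrX ler_nat -mulnn; case: (f w) => // n; rewrite leq_pmulr.
Qed.

(** Squared mean plus variance. The shape [c * (a + b * x) ^+ 2 + e] is that of the next potential
    as a function of the next state. *)
Lemma integral_affine_sqr (f : T -> nat) (c a b e : R) :
  let mu := fine (\int[P]_w ((f w)%:R : R)%:E) in
  let m2 := fine (\int[P]_w (((f w)%:R : R) ^+ 2)%:E) in
  (forall n, measurable (f @^-1` [set n])) ->
  (\int[P]_w (((f w)%:R : R) ^+ 2)%:E < +oo)%E ->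
  (\int[P]_w (c * (a + b * (f w)%:R) ^+ 2 + e)%:E =
   (c * ((a + b * mu) ^+ 2 + b ^+ 2 * (m2 - mu ^+ 2)) + e)%:E)%E.
Proof.
move=> mu m2 mf f2; have [i2 i1] := integrable_nat mf f2.
have muE : (\int[P]_w ((f w)%:R : R)%:E = mu%:E)%E.
  by rewrite fineK // integrable_fin_num.
have m2E : (\int[P]_w (((f w)%:R : R) ^+ 2)%:E = m2%:E)%E.
  by rewrite fineK // integrable_fin_num.
have i0 := finite_measure_integrable_cst P (c * a ^+ 2 + e) (@measurableT _ T).
transitivity (\int[P]_w (((c * b ^+ 2)%:E * (((f w)%:R : R) ^+ 2)%:E +
   (2 * c * a * b)%:E * ((f w)%:R : R)%:E) + (c * a ^+ 2 + e)%:E))%E.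
  by apply: eq_integral => w _; rewrite -!EFinM -!EFinD; congr (_%:E); ring.
rewrite integralD //; last 1 first.
  by apply: integrableD => //; apply: integrableZl.
rewrite integralD //; [|exact: integrableZl..].
rewrite !integralZl // muE m2E integral_cst //= probability_setT mule1.
by rewrite -!EFinM -!EFinD; congr (_%:E); ring.
Qed.

End Moments.

(** * The supermartingale inequality *)

Section Potential.
Context (R : realType).
Implicit Types (N A kappa : R) (y : nat).

Definition root4 A : R := Num.sqrt (Num.sqrt A).

(** The second term decreases as [A] grows and pays for the variance gained by [N]. *)
Definition potential kappa N A : R := N ^+ 2 / root4 A ^+ 7 + kappa / root4 A.

Lemma root4X A : 0 <= A -> root4 A ^+ 4 = A.
Proof. by move=> A0; rewrite (exprM _ 2 2) !sqr_sqrtr ?sqrtr_ge0. Qed.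

Lemma root4_gt0 A : 0 < A -> 0 < root4 A.
Proof. by move=> A0; rewrite !sqrtr_gt0. Qed.

Lemma ler_root4 A A' : A <= A' -> root4 A <= root4 A'.
Proof. by move=> AA'; rewrite !ler_wsqrtr. Qed.

Lemma potential_ge0 kappa N A : 0 <= kappa -> 0 <= potential kappa N A.
Proof.
move=> k0; have q0 : 0 <= root4 A by exact: sqrtr_ge0.
by rewrite addr_ge0 // divr_ge0 ?sqr_ge0 ?exprn_ge0.
Qed.

(* Writing [q < q'] for the fourth roots of [A < A'], the point is that
   [y <= q' ^+ 2], so that the variance term is at most
   [C (q' ^ 4 - q ^ 4) q' ^ 2 / q' ^ 7 <= 4 C (1 / q - 1 / q')]. *)
Lemma potential_supermartingale (C V N A : R) (y : nat) : 0 <= C -> 1 <= A ->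
  V <= C * y%:R ^+ 3 ->
  (N ^+ 2 + V) / root4 (A + y%:R ^+ 2) ^+ 7 + 4 * C / root4 (A + y%:R ^+ 2)
  <= potential (4 * C) N A.
Proof.
move=> C0 A1 VC; set A' := A + _; set q := root4 A; set p := root4 A'.
have y0 : 0 <= y%:R :> R by [].
have A0 : 0 < A by apply: lt_le_trans A1.
have AA' : A <= A' by rewrite lerDl sqr_ge0.
have A'0 : 0 < A' by apply: lt_le_trans AA'.
have q0 : 0 < q := root4_gt0 A0.
have p0 : 0 < p := root4_gt0 A'0.
have qp : q <= p := ler_root4 AA'.
have qA : q ^+ 4 = A := root4X (ltW A0).
have pA : p ^+ 4 = A' := root4X (ltW A'0).
have y2 : y%:R ^+ 2 = p ^+ 4 - q ^+ 4 by rewrite pA qA /A'; ring.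
have yp : y%:R <= p ^+ 2.
  rewrite -(@ler_pXn2r _ 2) ?nnegrE ?exprn_ge0 ?(ltW p0) // y2 -exprM.
  by rewrite gerBl exprn_ge0 // ltW.
have VB : V / p ^+ 7 <= 4 * C * (1 / q - 1 / p).
  rewrite ler_pdivrMr ?exprn_gt0 //; apply: (le_trans VC).
  have -> : 4 * C * (1 / q - 1 / p) * p ^+ 7 =
            C * ((p - q) * (4 * p ^+ 3) * (p ^+ 3 / q)).
    by field; rewrite !gt_eqF.
  apply: ler_wpM2l => //.
  (* The factor [y ^+ 2 = p ^+ 4 - q ^+ 4] is compared with [(p - q) * (4 * p ^+ 3)], and
     [y <= p ^+ 2] with [p ^+ 3 / q]. *)
  have -> : y%:R ^+ 3 = y%:R ^+ 2 * y%:R :> R by ring.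
  have pq : p ^+ 2 <= p ^+ 3 / q.
    rewrite ler_pdivlMr // [leRHS]exprSr; apply: ler_wpM2l => //.
    exact: sqr_ge0.
  apply: ler_pM => //; last exact: le_trans pq.
  rewrite y2.
  have -> : p ^+ 4 - q ^+ 4 = (p - q) * (p ^+ 3 + p ^+ 2 * q + p * q ^+ 2 + q ^+ 3).
    by ring.
  apply: ler_wpM2l; first by rewrite subr_ge0.
  have h1 : p ^+ 2 * q <= p ^+ 3 by rewrite [leRHS]exprSr; apply: ler_wpM2l => //; exact: sqr_ge0.
  have h2 : p * q ^+ 2 <= p ^+ 3.
    rewrite [leRHS]exprS; apply: ler_wpM2l; first exact: ltW.
    by rewrite lerXn2r ?nnegrE ?(ltW p0) ?(ltW q0).
  have h3 : q ^+ 3 <= p ^+ 3 by rewrite lerXn2r ?nnegrE ?(ltW p0) ?(ltW q0).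
  by lra.
have NB : N ^+ 2 / p ^+ 7 <= N ^+ 2 / q ^+ 7.
  rewrite ler_wpM2l ?sqr_ge0 // lef_pV2 ?posrE ?exprn_gt0 //.
  by rewrite lerXn2r ?nnegrE ?(ltW p0) ?(ltW q0).
rewrite /potential mulrDl -/q.
have -> : 4 * C / q = 4 * C * (1 / q - 1 / p) + 4 * C / p.
  by field; rewrite !gt_eqF.
by lra.
Qed.

End Potential.

(** * The INAR(1) process *)

Section INAR.
Context (d : measure_display) (T : measurableType d) (R : realType).
Context (P : probability T R) (alpha : R).
Context (X0 : T -> nat) (eps : nat -> T -> nat) (xi : nat -> nat -> T -> nat).

Local Notation Z := (inar_family X0 eps xi).
Local Notation X := (inar X0 eps xi).

Hypothesis alpha01 : 0 < alpha < 1.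
Hypothesis mZ : forall i n, measurable (Z i @^-1` [set n]).
Hypothesis indepZ : mutually_independent P Z.
Hypothesis eps_id : forall k n, (0 < k)%N ->
  P (eps k @^-1` [set n]) = P (eps 1%N @^-1` [set n]).
Hypothesis eps2 : (\int[P]_w (((eps 1%N w)%:R : R) ^+ 2)%:E < +oo)%E.
Hypothesis xi_bernoulli : forall k j, (0 < k)%N -> (0 < j)%N ->
  P (xi k j @^-1` [set 1%N]) = alpha%:E /\
  P (xi k j @^-1` [set 0%N]) = (1 - alpha)%:E.

Local Notation mu := (fine (\int[P]_w ((eps 1%N w)%:R : R)%:E)).
Local Notation m2 := (fine (\int[P]_w (((eps 1%N w)%:R : R) ^+ 2)%:E)).

Let var_eps_ge0 : 0 <= m2 - mu ^+ 2.
Proof.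
have := @integral_affine_sqr _ _ _ P (eps 1%N) 1 (- mu) 1 0
  (fun n => mZ (Some (inl 0%N)) n) eps2.
rewrite !mul1r addNr expr0n /= add0r expr1n mul1r addr0 => /esym h.
rewrite -lee_fin h; apply: integral_ge0 => w _.
by rewrite lee_fin addr0 mul1r sqr_ge0.
Qed.

Let var_xi_ge0 : 0 <= alpha * (1 - alpha).
Proof. by case/andP: alpha01 => a0 a1; rewrite mulr_ge0 ?subr_ge0 ?ltW. Qed.

Lemma discrete_map_inar k : discrete_map (X k).
Proof.
elim: k => [|k IHk]; first exact: discrete_map_nat (mZ None).
apply: (discrete_map2 addn (f := fun w => \sum_(j < X k w) xi k.+1 j.+1 w)%N).
  apply: (@discrete_map_diag _ _ (X k)
    (fun n w => \sum_(j < n) xi k.+1 j.+1 w)%N) => // n.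
  apply: (@discrete_map_sum _ _ _ n (fun j => xi k.+1 j.+1)) => j.
  exact: discrete_map_nat (mZ (Some (inr (k, j)))).
exact: discrete_map_nat (mZ (Some (inl k))).
Qed.

(* [stage k t]: the variables still unrevealed when [X_0, ..., X_k] and
   [xi_{k+1,1}, ..., xi_{k+1,t}] are known. *)
Definition stage (k t : nat) : set inar_index := fun i =>
  match i with
  | None => False
  | Some (inl l) => (k <= l)%N
  | Some (inr (l, j)) => (k < l)%N \/ l = k /\ (t <= j)%N
  end.

(** On [E], [t] thinning variables with sum [u] are revealed and [r] remain, so [X k.+1] has mean
    [u + alpha * r + mu] and variance [r * (alpha * (1 - alpha)) + (m2 - mu ^+ 2)]. The induction on
    [r] reveals the remaining ones singly. *)
Lemma inar_step_le (k r t u : nat) (E F : set T) (c a b e : R) :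
  0 <= c -> 0 <= e -> measurable F -> indep_event P Z E (stage k t) ->
  (forall w, E w -> X k w = (t + r)%N) ->
  (forall w, E w -> (\sum_(j < t) xi k.+1 j.+1 w)%N = u) ->
  (forall (E' : set T) z, indep_event P Z E' (stage k.+1 0) -> E' `<=` E ->
     (forall w, E' w -> X k.+1 w = z) ->
     (P (E' `&` F) <= P E' * (c * (a + b * z%:R) ^+ 2 + e)%:E)%E) ->
  (P (E `&` F) <= P E *
    (c * ((a + b * (u%:R + alpha * r%:R + mu)) ^+ 2 +
          b ^+ 2 * (r%:R * (alpha * (1 - alpha)) + (m2 - mu ^+ 2))) + e)%:E)%E.
Proof.
move=> c0 e0 mF; elim: r t u E => [|r IHr] t u E iE XE uE H.
  (* No thinning variable is left: revealing [eps k.+1] determines [X k.+1]. *)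
  pose g n : R := c * (a + b * (u + n)%:R) ^+ 2 + e.
  have g0 n : 0 <= g n by rewrite addr_ge0 // mulr_ge0 // sqr_ge0.
  have Si : stage k t (Some (inl k)) by exact: leqnn.
  have -> : ((c * ((a + b * (u%:R + alpha * 0%:R + mu)) ^+ 2 +
      b ^+ 2 * (0%:R * (alpha * (1 - alpha)) + (m2 - mu ^+ 2))) + e)%:E =
      \int[P]_w (g (eps k.+1 w))%:E)%E.
    rewrite [RHS]integral_nat_split //; last exact: mZ (Some (inl k)).
    under eq_eseriesr do rewrite eps_id //.
    rewrite -integral_nat_split //; last exact: mZ (Some (inl 0%N)).
    transitivity (\int[P]_w
        (c * ((a + b * u%:R) + b * (eps 1%N w)%:R) ^+ 2 + e)%:E)%E.
      rewrite integral_affine_sqr //; last exact: mZ (Some (inl 0%N)).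
      by congr (_%:E); ring.
    by apply: eq_integral => w _; rewrite /g natrD; congr (_%:E); ring.
  apply: (indep_event_split_le mZ iE Si mF g0) => n _.
  apply: H => [||w [Ew /= <-]]; last by rewrite XE // addn0 uE.
    apply: indep_event_sub (indep_eventI mZ n iE Si).
    move=> [[l|[l j]]|] //= h; split=> //.
    - exact: ltnW.
    - by move=> [lk]; rewrite lk ltnn in h.
    - by left; case: h => [/ltnW|[-> _]].
  exact: subIsetl.
(* Revealing [xi k.+1 t.+1] moves one unit from [r] to [t]; averaging the induction bound over it
   gives the bound for [r.+1]. *)
pose g n : R := c * ((a + b * ((u + n)%:R + alpha * r%:R + mu)) ^+ 2 +
  b ^+ 2 * (r%:R * (alpha * (1 - alpha)) + (m2 - mu ^+ 2))) + e.
have g0 n : 0 <= g n.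
  by rewrite addr_ge0 // mulr_ge0 // addr_ge0 ?sqr_ge0 // mulr_ge0 ?sqr_ge0 //
     addr_ge0 // mulr_ge0.
have Si : stage k t (Some (inr (k, t))) by right.
have -> : ((c * ((a + b * (u%:R + alpha * r.+1%:R + mu)) ^+ 2 +
    b ^+ 2 * (r.+1%:R * (alpha * (1 - alpha)) + (m2 - mu ^+ 2))) + e)%:E =
    \int[P]_w (g (xi k.+1 t.+1 w))%:E)%E.
  have [x1 x0] := xi_bernoulli (ltn0Sn k) (ltn0Sn t).
  rewrite (integral_bernoulli _ g0 x1 x0); last exact: mZ (Some (inr (k, t))).
  by rewrite /g !natrD -(natr1 r); congr (_%:E); ring.
apply: (indep_event_split_le mZ iE Si mF g0) => n _.
apply: (IHr t.+1).
- apply: indep_event_sub (indep_eventI mZ n iE Si).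
  move=> [[l|[l j]]|] //= h; split=> //.
  + by case: h => [|[-> /ltnW]]; [left|right].
  + by move=> [lk jt]; case: h => [|[_]]; rewrite ?lk ?jt ltnn.
- by move=> w [Ew _]; rewrite XE // addnS.
- by move=> w [Ew /= <-]; rewrite big_ord_recr /= uE.
- by move=> E' z iE' E'E; apply: H => //; apply: subset_trans E'E _; exact: subIsetl.
Qed.

(** * The maximal inequality along the chain *)

Definition inar_N (k : nat) (w : T) : R :=
  \sum_(l < k) (X l w)%:R * ((X l.+1 w)%:R - alpha * (X l w)%:R - mu).

Definition inar_A (k : nat) (w : T) : R := 1 + \sum_(l < k) (X l w)%:R ^+ 2.

Lemma inar_NS k w : inar_N k.+1 w =
  inar_N k w + (X k w)%:R * ((X k.+1 w)%:R - alpha * (X k w)%:R - mu).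
Proof. exact: big_ord_recr. Qed.

Lemma inar_AS k w : inar_A k.+1 w = inar_A k w + (X k w)%:R ^+ 2.
Proof. by rewrite /inar_A big_ord_recr addrA. Qed.

(** The constant [4 * C] of [potential_supermartingale] with [C = 1 + m2]: here [1] bounds
    [alpha * (1 - alpha)] and [m2] bounds the innovation variance. *)
Let kappa : R := 4 * (1 + m2).

Let m2_ge0 : 0 <= m2.
Proof. by rewrite fine_ge0 // integral_ge0 // => w _; rewrite lee_fin sqr_ge0. Qed.

Definition exceeds (lam : R) (k n : nat) : set T :=
  [set w | exists2 j, (k <= j <= k + n)%N &
    lam <= potential kappa (inar_N j w) (inar_A j w)].

Lemma measurable_exceeds lam k n : measurable (exceeds lam k n).
Proof.
have dN j : discrete_map (inar_N j).
  apply: (@discrete_map_sum _ _ R j (fun l w =>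
    (X l w)%:R * ((X l.+1 w)%:R - alpha * (X l w)%:R - mu))) => l.
  exact: (discrete_map2 (fun x y => x%:R * (y%:R - alpha * x%:R - mu))
    (discrete_map_inar l) (discrete_map_inar l.+1)).
have dA j : discrete_map (inar_A j).
  apply: (discrete_map_comp (fun x => 1 + x)).
  apply: (@discrete_map_sum _ _ R j (fun l w => (X l w)%:R ^+ 2)) => l.
  exact: (discrete_map_comp (fun x => x%:R ^+ 2) (discrete_map_inar l)).
have -> : exceeds lam k n = \bigcup_(j in [set j | (k <= j <= k + n)%N])
    ((fun w => potential kappa (inar_N j w) (inar_A j w)) @^-1` [set x | lam <= x]).
  by apply/seteqP; split=> w [j jk h]; exists j.
apply: bigcup_measurable => j _; apply: discrete_map_measurable.
exact: discrete_map2.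
Qed.

(* Doob's maximal inequality for the nonnegative supermartingale
   [potential kappa N_k A_k]. *)
Lemma exceeds_le (lam : R) (n k y : nat) (E : set T) (N A : R) :
  0 < lam -> 1 <= A -> indep_event P Z E (stage k 0) ->
  (forall w, E w -> [/\ X k w = y, inar_N k w = N & inar_A k w = A]) ->
  (P (E `&` exceeds lam k n) <= P E * (potential kappa N A / lam)%:E)%E.
Proof.
move=> lam0; have k0 : 0 <= kappa by rewrite mulr_ge0 // addr_ge0.
(* Where the level is already reached, the claimed bound is at least [P E']. *)
have large k' n' (E' : set T) N' A' :
    measurable E' -> lam <= potential kappa N' A' ->
    (P (E' `&` exceeds lam k' n') <= P E' * (potential kappa N' A' / lam)%:E)%E.
  move=> mE lamU; apply: (@le_trans _ _ (P E')).
    apply: le_measure; rewrite ?inE //.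
    by apply: measurableI => //; exact: measurable_exceeds.
  by rewrite -[leLHS]mule1 lee_wpmul2l // lee_fin ler_pdivlMr // mul1r.
elim: n k y E N A => [|n IHn] k y E N A A1 iE cE;
  have [/(large k)|Ulam] := lerP lam (potential kappa N A);
  do ?[by apply; case: iE].
  have -> : E `&` exceeds lam k 0 = set0.
    apply/seteqP; split=> // w [/cE [_ NE AE]] [j]; rewrite addn0 -eqn_leq => /eqP <-.
    by rewrite NE AE leNgt Ulam.
  by rewrite measure0 mule_ge0 // lee_fin divr_ge0 ?potential_ge0 ?(ltW lam0).
(* The level is not reached at time [k], so the window may start at [k.+1] and is one step
   shorter. *)
have -> : E `&` exceeds lam k n.+1 = E `&` exceeds lam k.+1 n.
  apply/seteqP; split=> w [Ew [j jk h]]; split=> //; exists j => //.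
    move: jk; rewrite addSnnS leq_eqVlt; case: eqVneq => //= kj _.
    by move: h; rewrite -kj; have [_ -> ->] := cE w Ew; rewrite leNgt Ulam.
  by move: jk; rewrite addSnnS => /andP[/ltnW -> ->].
set A' := A + y%:R ^+ 2.
have A'1 : 1 <= A' by rewrite (le_trans A1) // lerDl sqr_ge0.
have q0 : 0 < root4 A' by rewrite root4_gt0 // (lt_le_trans ltr01).
(* As a function of [X k.+1 = z], the next potential over [lam] is [c * (a + y * z) ^+ 2 + e] with
   [a = N - y * (alpha * y + mu)]. *)
pose c : R := 1 / (root4 A' ^+ 7 * lam).
pose e : R := kappa / root4 A' / lam.
have c0 : 0 <= c by rewrite divr_ge0 // mulr_ge0 ?exprn_ge0 ?ltW.
have e0 : 0 <= e by rewrite !divr_ge0 // ltW.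
have step := @inar_step_le k y 0 0 E (exceeds lam k.+1 n) c
  (N - y%:R * (alpha * y%:R + mu)) y%:R e c0 e0 (measurable_exceeds _ _ _) iE.
apply: le_trans (step _ _ _) _.
- by move=> w /cE [].
- by move=> w _; rewrite big_ord0.
- move=> E' z iE' E'E Xz.
  have -> : c * (N - y%:R * (alpha * y%:R + mu) + y%:R * z%:R) ^+ 2 + e =
    potential kappa (N + y%:R * (z%:R - alpha * y%:R - mu)) A' / lam.
    rewrite /c /e /potential.
    by field; rewrite !gt_eqF.
  apply: (IHn k.+1 z) => // w E'w; have [Xy NE AE] := cE w (E'E w E'w).
  split; first exact: Xz.
    by rewrite inar_NS NE Xy Xz.
  by rewrite inar_AS AE Xy.
rewrite lee_wpmul2l // lee_fin.
(* At the mean of [X k.+1] the increment of [N] cancels, leaving [N ^+ 2] and the variance. *)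
have -> : c * ((N - y%:R * (alpha * y%:R + mu) +
    y%:R * (0%:R + alpha * y%:R + mu)) ^+ 2 +
    y%:R ^+ 2 * (y%:R * (alpha * (1 - alpha)) + (m2 - mu ^+ 2))) + e =
  ((N ^+ 2 + y%:R ^+ 2 * (y%:R * (alpha * (1 - alpha)) + (m2 - mu ^+ 2))) /
    root4 A' ^+ 7 + kappa / root4 A') / lam.
  by rewrite /c /e; field; rewrite !gt_eqF.
rewrite ler_pM2r ?invr_gt0 //.
apply: potential_supermartingale => //; first by rewrite addr_ge0.
(* Since [y] is a natural number, both variance terms are at most a multiple of [y ^+ 3]. *)
have y_sqr : (y%:R : R) ^+ 2 <= y%:R ^+ 3.
  by rewrite -!natrX ler_nat; case: (y) => // m; rewrite leq_pexp2l.
have a1 : alpha * (1 - alpha) <= 1.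
  case/andP: alpha01 => a0 a1.
  by rewrite mulr_ile1 // ?subr_ge0 ?gerBl ltW.
have y3 : (0 : R) <= y%:R ^+ 3 by rewrite exprn_ge0.
have h1 : y%:R ^+ 3 * (alpha * (1 - alpha)) <= y%:R ^+ 3 by rewrite ler_piMr.
have h2 : y%:R ^+ 2 * (m2 - mu ^+ 2) <= y%:R ^+ 3 * m2.
  by apply: ler_pM => //; rewrite ?gerBl sqr_ge0.
have -> : y%:R ^+ 2 * (y%:R * (alpha * (1 - alpha)) + (m2 - mu ^+ 2)) =
  y%:R ^+ 3 * (alpha * (1 - alpha)) + y%:R ^+ 2 * (m2 - mu ^+ 2) by ring.
by rewrite mulrDl mul1r (mulrC m2) lerD.
Qed.

(** At time [0] the potential is [kappa] whatever [X0] is; splitting along [X0] gives the events of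
    known state that [exceeds_le] asks for. *)
Lemma exceeds_le0 (lam : R) n : 0 < lam ->
  (P (exceeds lam 0 n) <= (kappa / lam)%:E)%E.
Proof.
move=> lam0.
have iT : indep_event P Z setT setT by exact: indep_eventT.
have k0 : 0 <= kappa by rewrite mulr_ge0 // addr_ge0.
have r1 : root4 1 = 1 :> R by rewrite /root4 !sqrtr1.
have := @indep_event_split_le _ _ _ P _ _ mZ _ _ (exceeds lam 0 n) None (fun=> kappa / lam) iT I.
rewrite setTI integral_cst //= !probability_setT mul1e mule1; apply.
- exact: measurable_exceeds.
- by move=> _; rewrite divr_ge0 // ltW.
move=> m _; have := @exceeds_le lam n 0 m (setT `&` X0 @^-1` [set m]) 0 1 lam0 (lexx _).
rewrite /potential r1 !expr1n expr0n /= mul0r add0r divr1; apply.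
  apply: indep_event_sub (@indep_eventI _ _ _ P _ Z mZ _ _ None m iT I).
  by move=> [i|] //= _; split.
by move=> w [_ /= <-]; rewrite /inar_N /inar_A !big_ord0 addr0.
Qed.

(** Letting the horizon grow, the level [m.+1] is ever reached with probability at most
    [kappa / m.+1], so reaching all levels is a null event. *)
Lemma potential_bounded : {ae P, forall w,
  exists m : R, forall j, potential kappa (inar_N j w) (inar_A j w) < m}.
Proof.
pose B m := \bigcup_n exceeds m.+1%:R 0 n.
have mB m : measurable (B m).
  by apply: bigcupT_measurable => n; exact: measurable_exceeds.
have PB m : (P (B m) <= (kappa / m.+1%:R)%:E)%E.
  have : (P \o exceeds m.+1%:R 0) x @[x --> \oo] --> P (B m).
    apply: nondecreasing_cvg_mu; [exact: measurable_exceeds|exact: mB|].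
    move=> n n' nn'; apply/subsetPset => w [j jn h]; exists j => //.
    by move: jn; rewrite !add0n => /leq_trans; apply.
  move=> /cvg_lim <- //; apply: lime_le; last first.
    by near=> n; exact: exceeds_le0.
  apply: ereal_nondecreasing_is_cvgn => n n' nn'.
  apply: le_measure; rewrite ?inE; do ?exact: measurable_exceeds.
  by move=> w [j jn h]; exists j => //; move: jn; rewrite !add0n => /leq_trans; apply.
exists (\bigcap_m B m); split.
- exact: bigcapT_measurable.
- apply/eqP; rewrite eq_le measure_ge0 andbT.
  apply/lee_addgt0Pr => e e0; rewrite add0e.
  have [m Hm] : exists m, kappa / m.+1%:R <= e.
    exists (Num.trunc (kappa / e)); rewrite ler_pdivrMr // mulrC -ler_pdivrMr //.
    by apply: ltW; rewrite truncnS_gt.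
  apply: (@le_trans _ _ (P (B m))).
    by apply: le_measure; rewrite ?inE //; [exact: bigcapT_measurable|exact: bigcap_inf].
  by apply: le_trans (PB m) _; rewrite lee_fin.
move=> w /= H m _; apply: contrapT => nB; apply: H; exists m.+1%:R => j.
rewrite ltNge; apply/negP => h; apply: nB; exists j => //.
by exists j; rewrite ?leq0n ?add0n /=.
Unshelve. all: by end_near.
Qed.

(** * Growth of [inar_A] and the law of large numbers *)

Hypothesis eps_neq0 : (0 < P [set w | eps 1%N w != 0%N])%E.

(** By independence [n] given innovations all vanish with probability [p ^+ n], where [p < 1]. Hence
    each tail of zeros is null, and there are countably many tails. *)
Lemma eps_infinitely_often : {ae P, forall w,
  forall m, exists2 k, (m <= k)%N & eps k.+1 w <> 0%N}.
Proof.
have me : forall k, measurable (eps k.+1 @^-1` [set 0%N]).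
  by move=> k; exact: mZ (Some (inl k)) 0%N.
set p := fine (P (eps 1%N @^-1` [set 0%N])).
have pE : P (eps 1%N @^-1` [set 0%N]) = p%:E.
  by rewrite fineK // fin_num_measure.
have p1 : p < 1.
  rewrite -lte_fin -pE ltNge; apply/negP => p1; move: eps_neq0.
  have -> : [set w | eps 1%N w != 0%N] = ~` (eps 1%N @^-1` [set 0%N]).
    by apply/seteqP; split=> w /= /eqP.
  rewrite probability_setC // lt0e => /andP[/eqP + _]; apply.
  have -> : P (eps 1%N @^-1` [set 0%N]) = 1%E.
    by apply/eqP; rewrite eq_le p1 andbT probability_le1.
  by rewrite subee.
have p0 : 0 <= p by rewrite fine_ge0.
pose B m := \bigcap_(k in [set k | (m <= k)%N]) (eps k.+1 @^-1` [set 0%N]).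
have mB m : measurable (B m) by apply: bigcap_measurable => //; exists m => /=.
have PB m n : (P (B m) <= (p ^+ n)%:E)%E.
  pose J : seq inar_index := [seq Some (inl l) | l <- iota m n].
  have uJ : uniq J by rewrite map_inj_uniq ?iota_uniq // => a b [].
  have := indepZ (fun=> 0%N) uJ; rewrite big_map.
  rewrite (eq_bigr (fun=> p%:E)); last by move=> l _ /=; rewrite eps_id.
  have -> : (\prod_(l <- iota m n) p%:E = (p ^+ n)%:E)%E.
    rewrite big_const_seq count_predT size_iota.
    by elim: n {J uJ} => //= n ->; rewrite -EFinM exprS.
  move=> <-.
  apply: le_measure; rewrite ?inE //.
    by apply: fin_bigcap_measurable => // i _; exact: mZ.
  move=> w Bw i /= /mapP[l]; rewrite mem_iota => /andP[ml _] ->.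
  exact: Bw.
have B0 m : P (B m) = 0%E.
  apply/eqP; rewrite eq_le measure_ge0 andbT.
  have fB : P (B m) \is a fin_num by rewrite fin_num_measure.
  rewrite -(fineK fB) lee_fin.
  have pn : (p ^+ n) @[n --> \oo] --> (0 : R).
    by apply: cvg_expr; rewrite ger0_norm.
  rewrite -(cvg_lim _ pn) //; apply: limr_ge; first by apply/cvg_ex; exists 0.
  by apply: nearW => n; rewrite -lee_fin fineK //; exact: PB.
have : P.-negligible (\bigcup_m B m).
  by apply: negligible_bigcup => m; exists (B m); split; [exact: mB|exact: B0|].
apply: negligibleS => w /= H; apply: contrapT => nB; apply: H => m.
apply: contrapT => h; apply: nB; exists m => // k /= mk.
by apply: contrapT => e; apply: h; exists k.
Unshelve. all: by end_near.
Qed.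

Lemma inar_A_nondecreasing w : {homo inar_A^~ w : k n / (k <= n)%N >-> k <= n}.
Proof. by apply/nondecreasing_seqP => k; rewrite inar_AS lerDl sqr_ge0. Qed.

Lemma inar_A_cvgy w : (forall m, exists2 k, (m <= k)%N & eps k.+1 w <> 0%N) ->
  inar_A k w @[k --> \oo] --> +oo.
Proof.
move=> io; have large (m : nat) : exists k, m%:R <= inar_A k w.
  elim: m => [|m [k mk]]; first by exists 0%N; rewrite /inar_A big_ord0 addr0.
  (* A nonzero [eps k'.+1] forces [1 <= X k'.+1], and this term enters [inar_A] at index [k'.+2]. *)
  have [k' kk' ek'] := io k; exists k'.+2; rewrite inar_AS -natr1 lerD //.
    apply: le_trans mk _; apply: inar_A_nondecreasing; exact: leqW.
  rewrite -natrX ler1n expn_gt0 orbF /= addn_gt0.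
  by apply/orP; right; rewrite lt0n; apply/eqP.
apply/cvgryPge => r; have [k kr] := large (Num.trunc r).+1.
near=> n; apply: (le_trans (ltW (truncnS_gt r))); apply: (le_trans kr).
by apply: inar_A_nondecreasing; near: n; exact: nbhs_infty_ge.
Unshelve. all: by end_near.
Qed.

(* [N ^+ 2 / A ^+ 2] is at most [potential kappa N A / root4 A]. *)
Lemma inar_N_negligible w (m : R) :
  (forall j, potential kappa (inar_N j w) (inar_A j w) < m) ->
  inar_A k w @[k --> \oo] --> +oo ->
  forall e, 0 < e -> \forall k \near \oo, `|inar_N k w| <= e * inar_A k w.
Proof.
(* This threshold gives [m <= e ^+ 2 * q] for [q = root4 A], whence [N ^+ 2 <= m * q ^+ 7 <= e ^+ 2
   * q ^+ 8 = (e * A) ^+ 2]. *)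
move=> bnd Aoo e e0; have /cvgryPge/(_ (1 + (m / e ^+ 2) ^+ 4)) Aoo' := Aoo.
near=> k; have AL : 1 + (m / e ^+ 2) ^+ 4 <= inar_A k w by near: k.
have := bnd k; set A := inar_A k w in AL *; set N := inar_N k w.
have k0 : 0 <= kappa by rewrite mulr_ge0 // addr_ge0.
have A0 : 0 < A.
  by apply: lt_le_trans AL; rewrite ltr_pwDl // (exprM _ 2 2) sqr_ge0.
have q0 := root4_gt0 A0; have := root4X (ltW A0).
set q := root4 A in q0 * => qA bk.
have Nm : N ^+ 2 <= m * q ^+ 7.
  rewrite -ler_pdivrMr ?exprn_gt0 //; apply: le_trans (ltW bk).
  by rewrite lerDl divr_ge0 // ltW.
have m0 : 0 < m by apply: le_lt_trans bk; exact: potential_ge0.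
have mq : m <= e ^+ 2 * q.
  rewrite mulrC -ler_pdivrMr ?exprn_gt0 //.
  rewrite -(@ler_pXn2r _ 4) ?nnegrE ?divr_ge0 ?exprn_ge0 ?(ltW q0) ?(ltW m0) ?(ltW e0) //.
  by rewrite qA; apply: le_trans AL; rewrite lerDr.
rewrite -(@ler_pXn2r _ 2) ?nnegrE ?mulr_ge0 ?(ltW e0) ?(ltW A0) //.
rewrite real_normK ?num_real //; apply: (le_trans Nm).
rewrite -qA exprMn -exprM (exprS _ 7) mulrA; apply: ler_wpM2r => //.
by rewrite exprn_ge0 // ltW.
Unshelve. all: by end_near.
Qed.

Lemma inar_slln : {ae P, forall w, inar_A k w @[k --> \oo] --> +oo /\
  forall e, 0 < e -> \forall k \near \oo, `|inar_N k w| <= e * inar_A k w}.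
Proof.
apply: filterS2 potential_bounded eps_infinitely_often => w [m bnd] io.
have Aoo := inar_A_cvgy io; split=> // e e0.
exact: inar_N_negligible bnd Aoo e e0.
Qed.

End INAR.

(** * The least squares problem *)

Section LeastSquares.
Context (R : realType).
Implicit Types (a t p q : R).

(* The expression is the exact increment of the objective from a critical point
   under the displacement [(p, q1, q2)], [a] being the displaced coefficient. *)
Lemma quadratic_gap_gt0 (K A a p q1 q2 b0 b1 b2 e2 e3 : R) :
  b0 ^+ 2 <= K -> b1 ^+ 2 <= K -> b2 ^+ 2 <= K -> e2 ^+ 2 <= K -> e3 ^+ 2 <= K ->
  33 * K + 1 <= A -> (p, q1, q2) <> (0, 0, 0) ->
  0 < A * p ^+ 2 + (q1 - p * b0) ^+ 2 + (q2 - a * q1 - p * b1) ^+ 2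
      + (a * q2 + p * b2) ^+ 2 - 2 * p * (e2 * q1 + e3 * q2).
Proof.
move=> b0K b1K b2K e2K e3K KA pq.
set v1 := q1 - p * b0; set v2 := q2 - a * q1 - p * b1; set v3 := a * q2 + p * b2.
have p2 : 0 <= p ^+ 2 by exact: sqr_ge0.
have scale b : b ^+ 2 <= K -> (p * b) ^+ 2 <= K * p ^+ 2.
  by move=> bK; rewrite exprMn mulrC ler_wpM2r.
have [B0 B1 B2 E2 E3] := And5 (scale _ b0K) (scale _ b1K) (scale _ b2K)
  (scale _ e2K) (scale _ e3K).
have sq2 x y : (x + y) ^+ 2 <= 2 * x ^+ 2 + 2 * y ^+ 2 :> R.
  by rewrite -subr_ge0 (_ : _ - _ = (x - y) ^+ 2) ?sqr_ge0 //; ring.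
have sq3 x y z : (x + y + z) ^+ 2 <= 3 * x ^+ 2 + 3 * y ^+ 2 + 3 * z ^+ 2 :> R.
  rewrite -subr_ge0 (_ : _ - _ = (x - y) ^+ 2 + (y - z) ^+ 2 + (x - z) ^+ 2); last by ring.
  by rewrite !addr_ge0 ?sqr_ge0.
have hq1 : q1 ^+ 2 <= 2 * v1 ^+ 2 + 2 * (K * p ^+ 2).
  have := sq2 v1 (p * b0); rewrite subrK; lra.
have hq2 : q2 ^+ 2 <= 3 * v2 ^+ 2 + 2 * v3 ^+ 2 + 3 * q1 ^+ 2 + 3 * (K * p ^+ 2).
  have v20 : 0 <= v2 ^+ 2 by exact: sqr_ge0.
  have v30 : 0 <= v3 ^+ 2 by exact: sqr_ge0.
  have q10 : 0 <= q1 ^+ 2 by exact: sqr_ge0.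
  have pb10 : 0 <= (p * b1) ^+ 2 by exact: sqr_ge0.
  (* For small [a] the term [v2] controls [q2]; for large [a] the term [v3] does. *)
  have [a1|a1] := lerP (a ^+ 2) 1.
    have := sq3 v2 (a * q1) (p * b1).
    rewrite (_ : v2 + _ + _ = q2); last by rewrite /v2; ring.
    have : (a * q1) ^+ 2 <= q1 ^+ 2 by rewrite exprMn ler_piMl.
    lra.
  have := sq2 v3 (- (p * b2)); rewrite sqrrN addrK.
  have : q2 ^+ 2 <= (a * q2) ^+ 2 by rewrite exprMn ler_peMl ?sqr_ge0 // ltW.
  lra.
have cross e q : (p * e) ^+ 2 <= K * p ^+ 2 ->
    2 * p * (e * q) <= 16 * (K * p ^+ 2) + q ^+ 2 / 16.
  move=> h; have : 0 <= (4 * (p * e) - q / 4) ^+ 2 by exact: sqr_ge0.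
  rewrite (_ : _ ^+ 2 = 16 * (p * e) ^+ 2 + q ^+ 2 / 16 - 2 * p * (e * q)); last by field.
  lra.
have c2 := cross _ q1 E2; have c3 := cross _ q2 E3.
have Ap : (33 * K + 1) * p ^+ 2 <= A * p ^+ 2 by rewrite ler_wpM2r.
(* The cross terms cost [32 * K * p ^+ 2] and [(q1 ^+ 2 + q2 ^+ 2) / 16]; the latter is at most
   [11 / 16 * K * p ^+ 2] plus half of the squares of [v1], [v2], [v3]. Hence the constant [33]. *)
have gap : p ^+ 2 + (v1 ^+ 2 + v2 ^+ 2 + v3 ^+ 2) / 2 <=
    A * p ^+ 2 + v1 ^+ 2 + v2 ^+ 2 + v3 ^+ 2 - 2 * p * (e2 * q1 + e3 * q2).
  have K0 : 0 <= K * p ^+ 2 by rewrite mulr_ge0 // (le_trans _ b0K) // sqr_ge0.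
  have v20 : 0 <= v2 ^+ 2 by exact: sqr_ge0.
  have v30 : 0 <= v3 ^+ 2 by exact: sqr_ge0.
  move: Ap; rewrite mulrDr mulrDl mul1r; lra.
apply: lt_le_trans gap; rewrite lt_neqAle; apply/andP; split; last first.
  by rewrite addr_ge0 // divr_ge0 // !addr_ge0 ?sqr_ge0.
apply/eqP => /esym/eqP.
rewrite paddr_eq0 ?divr_ge0 ?addr_ge0 ?sqr_ge0 // sqrf_eq0 => /andP[/eqP p0].
rewrite mulf_eq0 invr_eq0 pnatr_eq0 orbF !paddr_eq0 ?addr_ge0 ?sqr_ge0 //.
rewrite !sqrf_eq0 /v1 /v2 => /andP[/andP[/eqP v10 /eqP v20] _].
apply: pq; move: v10 v20; rewrite p0 !mul0r !subr0 => q10.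
by rewrite q10 mulr0 subr0 => ->.
Qed.

(** * Critical points and minimisers of the objective *)

Variables (mu alpha b0 y1 y2 b3 : R).

Let w a : R := 1 + a ^+ 2 + a ^+ 4.

Let w_gt0 a : 0 < w a.
Proof. by rewrite /w (exprM a 2 2) -addrA ltr_pwDl // addr_ge0 ?sqr_ge0. Qed.

(* The values at times [s] and [s+1] that minimise the three residuals
   involving them, given [b0] at time [s-1] and [b3] at time [s+2]; the
   minimising outlier sizes are [y1 - tau1 a] and [y2 - tau2 a]. *)
Definition tau1 a : R :=
  (a * (1 + a ^+ 2) * b0 + a ^+ 2 * b3 + (1 - a ^+ 3) * mu) / w a.

Definition tau2 a : R :=
  (a ^+ 2 * b0 + a * (1 + a ^+ 2) * b3 + (1 - a ^+ 3) * mu) / w a.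

Definition res1 a : R := tau1 a - a * b0 - mu.
Definition res2 a : R := tau2 a - a * tau1 a - mu.
Definition res3 a : R := b3 - a * tau2 a - mu.

(** The first order condition in the first outlier size; [res2E] is the one in the second. *)
Lemma res1E a : res1 a = a * res2 a.
Proof. have w0 := lt0r_neq0 (w_gt0 a).
by rewrite /res1 /res2 /tau1 /tau2 /w; field. Qed.

Lemma res2E a : res2 a = a * res3 a.
Proof. have w0 := lt0r_neq0 (w_gt0 a).
by rewrite /res2 /res3 /tau1 /tau2 /w; field. Qed.

(* At [(a, tau1 a, tau2 a)] the derivative of the objective in its coefficient
   vanishes iff [(a - alpha) * A - N = drift a]. *)
Definition drift a : R := res1 a * b0 + res2 a * tau1 a + res3 a * tau2 a.

(** Over the times unaffected by outliers, [D] stands for the sum of squared errors at [alpha], [N]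
    for that of errors times preceding values, and [A] for that of squared preceding values. *)
Definition objective (D N A a t1 t2 : R) : R :=
  D - 2 * (a - alpha) * N + (a - alpha) ^+ 2 * A
  + (y1 - a * b0 - mu - t1) ^+ 2
  + (y2 - a * y1 - mu + a * t1 - t2) ^+ 2
  + (b3 - a * y2 - mu + a * t2) ^+ 2.

Lemma critical_point_strict_min (D N A K a0 : R) :
  b0 ^+ 2 <= K -> tau1 a0 ^+ 2 <= K -> tau2 a0 ^+ 2 <= K ->
  res2 a0 ^+ 2 <= K -> res3 a0 ^+ 2 <= K -> 33 * K + 1 <= A ->
  (a0 - alpha) * A - N = drift a0 ->
  forall a t1 t2, (a, t1, t2) <> (a0, y1 - tau1 a0, y2 - tau2 a0) ->
  objective D N A a0 (y1 - tau1 a0) (y2 - tau2 a0) < objective D N A a t1 t2.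
Proof.
move=> h0 h1 h2 h3 h4 hA crit a t1 t2 neq.
pose p := a - a0; pose q1 := y1 - t1 - tau1 a0; pose q2 := y2 - t2 - tau2 a0.
have := @quadratic_gap_gt0 K A a p q1 q2 b0 (tau1 a0) (tau2 a0) (res2 a0) (res3 a0)
  h0 h1 h2 h3 h4 hA.
have pq : (p, q1, q2) <> (0, 0, 0).
  move=> [/eqP]; rewrite subr_eq0 => /eqP ea /eqP; rewrite subr_eq0 => /eqP e1.
  move=> /eqP; rewrite subr_eq0 => /eqP e2; apply: neq.
  by rewrite ea -e1 -e2 !subKr.
move=> /(_ pq) gap; rewrite -subr_gt0; apply: lt_le_trans gap _.
have c2 := res2E a0; have c1 := res1E a0.
(* The first order terms of the expansion, each zero, are added so that a polynomial identity in
   [tau1 a0] and [tau2 a0] remains. *)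
have crit' : 2 * p * ((a0 - alpha) * A - N - drift a0) = 0 by rewrite crit subrr mulr0.
have c1' : 2 * q1 * (res1 a0 - a0 * res2 a0) = 0 by rewrite c1 subrr mulr0.
have c2' : 2 * q2 * (res2 a0 - a0 * res3 a0) = 0 by rewrite c2 subrr mulr0.
rewrite -[leLHS]addr0 -crit' -[leLHS]addr0 -c1' -[leLHS]addr0 -c2'.
rewrite le_eqVlt; apply/orP; left; apply/eqP.
rewrite /objective /drift /res1 /res2 /res3 /p /q1 /q2.
move: (tau1 a0) (tau2 a0) => T1 T2; ring.
Qed.

Let continuousC (c : R) : continuous (fun _ : R => c).
Proof. by move=> a; exact: cvg_cst. Qed.

Let continuousD (f g : R -> R) : continuous f -> continuous g ->
  continuous (fun a => f a + g a).
Proof. by move=> cf cg a; apply: cvgD; [exact: cf|exact: cg]. Qed.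

Let continuousN (f : R -> R) : continuous f -> continuous (fun a => - f a).
Proof. by move=> cf a; apply: cvgN; exact: cf. Qed.

Let continuousM (f g : R -> R) : continuous f -> continuous g ->
  continuous (fun a => f a * g a).
Proof. by move=> cf cg a; apply: cvgM; [exact: cf|exact: cg]. Qed.

Let continuous_id : continuous (fun a : R => a).
Proof. by move=> a; exact: cvg_id. Qed.

Let continuousV : continuous (fun a => (w a)^-1).
Proof.
have cw : continuous w.
  by apply: continuousD; [apply: continuousD; [exact: continuousC|]|];
    exact: exprn_continuous.
by move=> a; apply: cvgV; [rewrite gt_eqF // w_gt0|exact: cw].
Qed.

Lemma continuous_tau1 : continuous tau1.
Proof.
apply: continuousM continuousV.
apply: continuousD; first apply: continuousD; apply: continuousM => //;
  do ?[exact: continuousC|exact: exprn_continuous].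
- apply: continuousM => //; apply: continuousD; first exact: continuousC.
  exact: exprn_continuous.
- apply: continuousD; first exact: continuousC.
  by apply: continuousN; exact: exprn_continuous.
Qed.

Lemma continuous_tau2 : continuous tau2.
Proof.
apply: continuousM continuousV.
apply: continuousD; first apply: continuousD; apply: continuousM => //;
  do ?[exact: continuousC|exact: exprn_continuous].
- apply: continuousM => //; apply: continuousD; first exact: continuousC.
  exact: exprn_continuous.
- apply: continuousD; first exact: continuousC.
  by apply: continuousN; exact: exprn_continuous.
Qed.

Let continuousB (f g : R -> R) : continuous f -> continuous g ->
  continuous (fun a => f a - g a).
Proof. by move=> cf cg; apply: continuousD => //; exact: continuousN. Qed.

Lemma continuous_res : [/\ continuous res1, continuous res2 & continuous res3].
Proof.
have ct1 := continuous_tau1; have ct2 := continuous_tau2.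
split; (apply: continuousB; last exact: continuousC); apply: continuousB => //.
- by apply: continuousM => //; exact: continuousC.
- exact: continuousM.
- exact: continuousM.
Qed.

Lemma continuous_drift : continuous drift.
Proof.
have ct1 := continuous_tau1; have ct2 := continuous_tau2.
have [c1 c2 c3] := continuous_res.
apply: continuousD; [apply: continuousD|]; exact: continuousM.
Qed.

Lemma residuals_bounded (r : R) : 0 <= r -> exists K, forall a,
  alpha - r <= a <= alpha + r ->
  [/\ b0 ^+ 2 <= K, tau1 a ^+ 2 <= K, tau2 a ^+ 2 <= K, res2 a ^+ 2 <= K &
      res3 a ^+ 2 <= K].
Proof.
move=> r0; have [c1 c2 c3] := continuous_res.
pose f a := b0 ^+ 2 + tau1 a ^+ 2 + tau2 a ^+ 2 + res2 a ^+ 2 + res3 a ^+ 2.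
have cf : continuous f.
  have ct1 := continuous_tau1; have ct2 := continuous_tau2.
  have sq (g : R -> R) : continuous g -> continuous (fun a => g a ^+ 2).
    by move=> cg; apply: continuousM.
  do 4![apply: continuousD; last exact: sq].
  exact: continuousC.
have ab : alpha - r <= alpha + r by lra.
have [c _ fc] := EVT_max ab (continuous_subspaceT cf).
exists (f c) => a aI; have := fc a; rewrite in_itv /= => /(_ aI).
have := sqr_ge0 b0; have := sqr_ge0 (tau1 a); have := sqr_ge0 (tau2 a).
have := sqr_ge0 (res2 a); have := sqr_ge0 (res3 a).
by rewrite /f => *; split; lra.
Qed.

Lemma critical_point_exists (r : R) : 0 < r -> exists M, forall N A,
  `|N| + M <= r * A -> exists a, alpha - r <= a <= alpha + r /\
    (a - alpha) * A - N = drift a.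
Proof.
(* With this [M], [r * A] outweighs [N] and the drift at both ends of the interval, so [g] changes
   sign. *)
move=> r0; exists (`|drift (alpha + r)| + `|drift (alpha - r)|) => N A NA.
pose g a := (a - alpha) * A - N - drift a.
have cg : continuous g.
  apply: continuousB; last exact: continuous_drift.
  apply: continuousB; last exact: continuousC.
  apply: continuousM; last exact: continuousC.
  by apply: continuousB => //; exact: continuousC.
have ab : alpha - r <= alpha + r by lra.
have gl : g (alpha - r) <= 0.
  have := ler_norm (- N); have := ler_norm (- drift (alpha - r)).
  have := normr_ge0 (drift (alpha + r)); rewrite !normrN /g.
  by move=> h1 h2 h3; lra.
have gr : 0 <= g (alpha + r).
  have := ler_norm N; have := ler_norm (drift (alpha + r)).
  have := normr_ge0 (drift (alpha - r)); rewrite /g.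
  by move=> h1 h2 h3; lra.
have [||a aI ga] := @IVT R g _ _ 0 ab.
- exact: continuous_subspaceT.
- by rewrite ge_min gl le_max gr orbT.
exists a; split; first by move: aI; rewrite in_itv.
by move/eqP: ga; rewrite subr_eq0 => /eqP.
Qed.

Definition strict_minimizer (F : R -> R -> R -> R) (z : R * R * R) : Prop :=
  forall a t1 t2, (a, t1, t2) <> z -> F z.1.1 z.1.2 z.2 < F a t1 t2.

Lemma strict_minimizer_unique F z z' :
  strict_minimizer F z -> strict_minimizer F z' -> z = z'.
Proof.
move: z z' => [[a t1] t2] [[a' t1'] t2'] m m'; apply: contrapT => ne.
have := m _ _ _ (nesym ne); have := m' _ _ _ ne.
by move=> /= h1 /(lt_trans h1); rewrite ltxx.
Qed.

(** Each radius [r] yields its own critical point near [alpha]; uniqueness of strict minimisers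
    identifies them all with one [z n]. *)
Lemma least_squares_cvg (D N A : nat -> R) :
  (forall e M, 0 < e -> \forall n \near \oo, `|N n| + M <= e * A n) ->
  exists (n0 : nat) (z : nat -> R * R * R),
    [/\ forall n, (n0 <= n)%N -> strict_minimizer (objective (D n) (N n) (A n)) (z n),
        (z n).1.1 @[n --> \oo] --> alpha,
        (z n).1.2 @[n --> \oo] --> y1 - tau1 alpha &
        (z n).2 @[n --> \oo] --> y2 - tau2 alpha].
Proof.
move=> NA; pose F n := objective (D n) (N n) (A n).
(* The default [(0, 0, 0)] is taken only where no strict minimiser exists. *)
pose z n := xget (0, 0, 0) [set z | strict_minimizer (F n) z].
have zP n z' : strict_minimizer (F n) z' -> strict_minimizer (F n) (z n) /\ z n = z'.
  move=> m; have m' : strict_minimizer (F n) (z n) by apply: xgetPex; exists z'.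
  by split=> //; exact: strict_minimizer_unique m' m.
have main (r : R) : 0 < r <= 1 -> \forall n \near \oo,
    [/\ strict_minimizer (F n) (z n), `|alpha - (z n).1.1| <= r,
     (z n).1.2 = y1 - tau1 (z n).1.1 & (z n).2 = y2 - tau2 (z n).1.1].
  move=> /andP[r0 r1]; have [M HM] := critical_point_exists r0.
  (* Radius [1] suffices for [K], since every [r] considered is at most [1]. *)
  have [K HK] := residuals_bounded (@ler01 R).
  have e1 := NA r M r0; have e2 := NA 1 (33 * K + 1) ltr01.
  near=> n.
  have h1 : `|N n| + M <= r * A n by near: n.
  have [a [/andP[ra ar] ca]] := HM _ _ h1.
  have [|k0 k1 k2 k3 k4] := HK a; first by apply/andP; split; lra.
  have KA : 33 * K + 1 <= A n.
    have : `|N n| + (33 * K + 1) <= 1 * A n by near: n.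
    by have := normr_ge0 (N n); lra.
  have [m zE] := zP n _ (critical_point_strict_min (D n) k0 k1 k2 k3 k4 KA ca).
  split; [exact: m|rewrite zE /=..] => //.
  by rewrite ler_norml; apply/andP; split; lra.
have [n0 _ Hn0] := main 1 ltac:(by rewrite ltr01 lexx).
have acvg : (z n).1.1 @[n --> \oo] --> alpha.
  apply/cvgrPdist_le => e e0.
  have r0 : 0 < Num.min e 1 <= 1 by rewrite lt_min e0 ltr01 ge_min lexx orbT.
  apply: filterS (main _ r0) => n [_ h _ _]; apply: (le_trans h).
  by rewrite ge_min lexx.
exists n0, z; split=> //.
- by move=> n /Hn0 [].
- have : (y1 - tau1 (z n).1.1) @[n --> \oo] --> y1 - tau1 alpha.
    by apply: cvgB; [exact: cvg_cst|apply: continuous_cvg => //; exact: continuous_tau1].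
  apply: cvg_trans; apply: near_eq_cvg.
  by exists n0 => // n /Hn0 [].
- have : (y2 - tau2 (z n).1.1) @[n --> \oo] --> y2 - tau2 alpha.
    by apply: cvgB; [exact: cvg_cst|apply: continuous_cvg => //; exact: continuous_tau2].
  apply: cvg_trans; apply: near_eq_cvg.
  by exists n0 => // n /Hn0 [].
Unshelve. all: by end_near.
Qed.

End LeastSquares.

(** * Separating the times affected by outliers from the sums *)

Section OutlierSums.
Context (R : realType).

Local Notation regular s k := ((k != s) && (k != s.+1) && (k != s.+2)).

(** All exceptional times lie below [s.+3], so the correction does not depend on [n]. *)
Lemma sum_regular (f : nat -> R) (s n : nat) : (s.+2 <= n)%N ->
  \sum_(1 <= k < n.+1 | regular s k) f k =
  \sum_(k < n) f k.+1 - \sum_(1 <= k < s.+3 | ~~ regular s k) f k.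
Proof.
move=> sn; rewrite -(big_mkord xpredT (fun k => f k.+1)) -(big_add1 _ _ 0%N n.+1 xpredT).
rewrite [in RHS](bigID (fun k => regular s k)) /=.
rewrite [X in _ + X - _](@big_cat_nat _ _ _ s.+3) //=.
rewrite [X in _ + (_ + X) - _]big_nat_cond [X in _ + (_ + X) - _]big_pred0.
  by rewrite addr0 addrK.
move=> k; have [sk|//] := leqP s.+3 k.
by rewrite (gtn_eqF sk) (gtn_eqF (ltnW sk)) (gtn_eqF (ltnW (ltnW sk))) andbF.
Qed.

(** Each regular residual is its value at [alpha] minus [(a - alpha) * y k.-1]; the square is then
    expanded. *)
Lemma Qn_objective (mu alpha : R) (s n : nat) (y : nat -> R) (a t1 t2 : R) :
  Qn mu s n y a t1 t2 =
  objective mu alpha (y s.-1) (y s) (y s.+1) (y s.+2)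
    (\sum_(1 <= k < n.+1 | regular s k) (y k - alpha * y k.-1 - mu) ^+ 2)
    (\sum_(1 <= k < n.+1 | regular s k) y k.-1 * (y k - alpha * y k.-1 - mu))
    (\sum_(1 <= k < n.+1 | regular s k) y k.-1 ^+ 2) a t1 t2.
Proof.
rewrite /Qn /objective; congr (_ + _ + _ + _).
rewrite !mulr_sumr -sumrB -big_split /=; apply: eq_bigr => k _; ring.
Qed.

(** The time [s.+2] is excluded because its predecessor [s.+1] carries an outlier. *)
Lemma inar_ao_regular (T : Type) (X0 : T -> nat) eps xi (s th1 th2 k : nat) w :
  (0 < k)%N -> regular s k ->
  inar_ao X0 eps xi s th1 th2 k w = inar X0 eps xi k w /\
  inar_ao X0 eps xi s th1 th2 k.-1 w = inar X0 eps xi k.-1 w.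
Proof.
case: k => // k _ /andP[/andP[/negbTE ks]]; rewrite !eqSS => /negbTE ks1 /negbTE ks2.
by rewrite /inar_ao /= !eqSS ks ks1 ks2 !mul0n !addn0.
Qed.

End OutlierSums.

Theorem theorem3p5p1 (d : measure_display) (T : measurableType d) (R : realType)
  (P : probability T R)
  (alpha : R) (X0 : T -> nat) (eps : nat -> T -> nat) (xi : nat -> nat -> T -> nat)
  (s th1 th2 : nat) :
  0 < alpha < 1 ->
  (0 < s)%N -> (0 < th1)%N -> (0 < th2)%N ->
  (* measurability of all driving variables *)
  (forall i v, measurable (inar_family X0 eps xi i @^-1` [set v])) ->
  (* X_0, (eps_k)_{k>=1}, (xi_{k,j})_{k,j>=1} all mutually independent *)
  mutually_independent P (inar_family X0 eps xi) ->
  (* eps_k identically distributed *)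
  (forall k v, (0 < k)%N -> P (eps k @^-1` [set v]) = P (eps 1%N @^-1` [set v])) ->
  (\int[P]_w (((eps 1%N w)%:R : R) ^+ 2)%:E < +oo)%E ->
  (0 < P [set w | eps 1%N w != 0%N])%E ->
  (* xi_{k,j} Bernoulli with mean alpha *)
  (forall k j, (0 < k)%N -> (0 < j)%N ->
     P (xi k j @^-1` [set 1%N]) = alpha%:E /\
     P (xi k j @^-1` [set 0%N]) = (1 - alpha)%:E) ->
  (\int[P]_w (((X0 w)%:R : R) ^+ 2)%:E < +oo)%E ->
  let mu := fine (\int[P]_w ((eps 1%N w)%:R : R)%:E) in
  let Y := fun k w => ((inar_ao X0 eps xi s th1 th2 k w)%:R : R) in
  {ae P, forall w,
    exists n0 : nat, exists at1t2 : nat -> R * R * R,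
      (forall n, (n0 <= n)%N -> (s.+2 <= n)%N ->
         forall a t1 t2 : R, (a, t1, t2) <> at1t2 n ->
           Qn mu s n (Y ^~ w) (at1t2 n).1.1 (at1t2 n).1.2 (at1t2 n).2
           < Qn mu s n (Y ^~ w) a t1 t2) /\
      ((fun n => (at1t2 n).1.1) @ \oo --> alpha) /\
      ((fun n => (at1t2 n).1.2) @ \oo -->
         Y s w + (- alpha * (1 + alpha ^+ 2) * Y s.-1 w - alpha ^+ 2 * Y s.+2 w
                  - (1 - alpha ^+ 3) * mu) / (1 + alpha ^+ 2 + alpha ^+ 4)) /\
      ((fun n => (at1t2 n).2) @ \oo -->
         Y s.+1 w + (- alpha ^+ 2 * Y s.-1 w - alpha * (1 + alpha ^+ 2) * Y s.+2 w
                  - (1 - alpha ^+ 3) * mu) / (1 + alpha ^+ 2 + alpha ^+ 4))}.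
Proof.
move=> alpha01 s0 _ _ mZ indepZ eps_id eps2 eps_neq0 xi_bernoulli _ mu Y.
have slln := inar_slln alpha01 mZ indepZ eps_id eps2 xi_bernoulli eps_neq0.
apply: filterS slln => w [Aoo NA]; rewrite -/mu in NA.
pose y k := Y k w; pose x k : R := (inar X0 eps xi k w)%:R.
pose regular k := (k != s) && (k != s.+1) && (k != s.+2).
pose D n := \sum_(1 <= k < n.+1 | regular k) (y k - alpha * y k.-1 - mu) ^+ 2.
pose N n := \sum_(1 <= k < n.+1 | regular k) y k.-1 * (y k - alpha * y k.-1 - mu).
pose A n := \sum_(1 <= k < n.+1 | regular k) y k.-1 ^+ 2.
pose fN k := x k.-1 * (x k - alpha * x k.-1 - mu).
pose fA k := x k.-1 ^+ 2.
pose cN := \sum_(1 <= k < s.+3 | ~~ regular k) fN k.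
pose cA := \sum_(1 <= k < s.+3 | ~~ regular k) fA k.
have yx k : (0 < k)%N -> regular k -> y k = x k /\ y k.-1 = x k.-1.
  move=> k0 rk; rewrite /y /Y.
  by have [-> ->] := inar_ao_regular X0 eps xi th1 th2 w k0 rk.
have NE n : (s.+2 <= n)%N -> N n = inar_N P alpha X0 eps xi n w - cN.
  move=> sn.
  transitivity (\sum_(1 <= k < n.+1 | regular k) fN k); last exact: sum_regular.
  rewrite /N big_nat_cond [RHS]big_nat_cond; apply: eq_bigr => k /andP[/andP[k0 _] rk].
  by have [-> ->] := yx k k0 rk.
have AE n : (s.+2 <= n)%N -> A n = inar_A R X0 eps xi n w - 1 - cA.
  move=> sn; rewrite /inar_A (addrC 1) addrK.
  transitivity (\sum_(1 <= k < n.+1 | regular k) fA k); last exact: sum_regular.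
  rewrite /A big_nat_cond [RHS]big_nat_cond; apply: eq_bigr => k /andP[/andP[k0 _] rk].
  by have [_ ->] := yx k k0 rk.
have NA' e M : 0 < e -> \forall n \near \oo, `|N n| + M <= e * A n.
  move=> e0; have e2 : 0 < e / 2 by rewrite divr_gt0.
  (* Half of [e * inar_A] absorbs [inar_N], the other half the constants; [e * (1 + cA)] accounts
     for the shift from [inar_A] to [A]. *)
  have /cvgryPge/(_ ((M + `|cN| + e * (1 + cA)) / (e / 2))) Alarge := Aoo.
  have Nsmall := NA _ e2.
  near=> n.
  have sn : (s.+2 <= n)%N by near: n; exact: nbhs_infty_ge.
  have h1 : (M + `|cN| + e * (1 + cA)) / (e / 2) <= inar_A R X0 eps xi n w by near: n.
  have h2 : `|inar_N P alpha X0 eps xi n w| <= e / 2 * inar_A R X0 eps xi n w by near: n.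
  rewrite NE // AE //; move: h1; rewrite ler_pdivrMr // => h1.
  have := ler_normB (inar_N P alpha X0 eps xi n w) cN.
  move: h1 h2; lra.
have [n0 [z [zmin zalpha z1 z2]]] :=
  @least_squares_cvg R mu alpha (y s.-1) (y s) (y s.+1) (y s.+2) D N A NA'.
exists n0, z; split.
  move=> n n0n _ a t1 t2 ne; rewrite !(Qn_objective mu alpha).
  exact: zmin.
split=> //; split.
- rewrite [X in _ --> X](_ : _ = y s - tau1 mu (y s.-1) (y s.+2) alpha) //.
  by rewrite /tau1 -[in RHS]mulNr; congr (_ + _ / _); ring.
- rewrite [X in _ --> X](_ : _ = y s.+1 - tau2 mu (y s.-1) (y s.+2) alpha) //.
  by rewrite /tau2 -[in RHS]mulNr; congr (_ + _ / _); ring.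
Unshelve. all: by end_near.
Qed.
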